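(* Let $n\ge3$, let $a,b\in C_n$ with $a\ne\bar b$, and let $u,v\in\{a,b\}^*$. Then $u\ \ddot{\sim}\ v$ if and only if $u=v$.
   Context: Let $n\ge2$ and $C_n=\{1<2<\cdots<n<\bar n<\overline{n-1}<\cdots<\bar 1\}$; for $x\in\{1,\dots,n\}$ set $\bar{\bar x}=x$. $C_n^*$ is the free monoid of words over $C_n$ and $|w|_a$ the number of occurrences of the letter $a$ in $w$. Convention: the symbols $n+1$ and $\overline{n+1}$ never occur in any word. For $i\in\{1,\dots,n\}$, $w$ has an $i$-inversion if $w=w_1xw_2yw_3$ with $x\in\{i,\overline{i+1}\}$, $y\in\{i+1,\bar i\}$. Quasi-crystal structure on $C_n^*$: $\mathrm{wt}(w)=(|w|_1-|w|_{\bar1},\dots,|w|_n-|w|_{\bar n})\in\mathbb{Z}^n$. For $i\in\{1,\dots,n\}$: if $w$ has an $i$-inversion then $\ddot{\varepsilon}_i(w)=\ddot{\varphi}_i(w)=+\infty$ and $\ddot{e}_i(w),\ddot{f}_i(w)$ are undefined; otherwise $\ddot{\varepsilon}_i(w)=|w|_{i+1}+|w|_{\bar i}$, $\ddot{\varphi}_i(w)=|w|_i+|w|_{\overline{i+1}}$; $\ddot{e}_i(w)$ is defined iff $\ddot{\varepsilon}_i(w)>0$ and is obtained by replacing the right-most letter of $w$ lying in $\{i+1,\bar i\}$ by its image ($i+1\mapsto i$, $\bar i\mapsto\overline{i+1}$ for $i<n$; $\bar n\mapsto n$ for $i=n$); $\ddot{f}_i(w)$ is defined iff $\ddot{\varphi}_i(w)>0$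 and is obtained by replacing the left-most letter of $w$ lying in $\{i,\overline{i+1}\}$ by its image ($i\mapsto i+1$, $\overline{i+1}\mapsto\bar i$ for $i<n$; $n\mapsto\bar n$ for $i=n$). The connected component $C_n^*(w)$ is the set of words obtained from $w$ by finitely many (defined) applications of the operators $\ddot{e}_i,\ddot{f}_i$. Hypoplactic congruence: $u\ddot{\sim}v$ iff there is a bijection $\psi:C_n^*(u)\to C_n^*(v)$ with $\psi(u)=v$ such that for all $x\in C_n^*(u)$ and $i$: $\psi(x)$ has the same $\mathrm{wt},\ddot{\varepsilon}_i,\ddot{\varphi}_i$ as $x$, $\ddot{e}_i(\psi(x))$ is defined iff $\ddot{e}_i(x)$ is (and then $\psi(\ddot{e}_i(x))=\ddot{e}_i(\psi(x))$), and likewise for $\ddot{f}_i$. *)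

(* Defs.v *)
From mathcomp Require Import all_boot all_order all_algebra.
From mathcomp Require Import boolp classical_sets functions.

Set Implicit Arguments.
Unset Strict Implicit.
Unset Printing Implicit Defensive.

Import GRing.Theory.

(* The alphabet C_n. The letters k+1 and its barred version are
   (k, false) and (k, true) with k : 'I_n: indices are shifted by one.
   The linear order on C_n plays no role in the definitions below. *)
Definition letter (n : nat) : Type := ('I_n * bool)%type.

Definition word (n : nat) : Type := seq (letter n).

Section QuasiCrystal.
Variable n : nat.
Implicit Types (i : 'I_n) (x y : letter n) (w u v : word n).

Definition bar x : letter n := (x.1, ~~ x.2).

Definition wt w : 'rV[int]_n :=
  \row_i ((count_mem ((i, false) : letter n) w)%:Z
          - (count_mem ((i, true) : letter n) w)%:Z)%R.

(* x is i or the bar of i+1; when i is the last index, only i qualifies. *)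
Definition phi_letter i x : bool :=
  if x.2 then (x.1 : nat) == i.+1 else x.1 == i.

(* x is i+1 or the bar of i; when i is the last index, only bar i qualifies. *)
Definition eps_letter i x : bool :=
  if x.2 then x.1 == i else (x.1 : nat) == i.+1.

(* [insub i.+1] is the index i+1, or None when i is the last index. *)
Definition raise i x : letter n :=
  if x.2 then if insub i.+1 is Some j then (j, true) else (i, false)
  else (i, false).

Definition lower i x : letter n :=
  if x.2 then (i, true)
  else if insub i.+1 is Some j then (j, false) else (i, true).

Fixpoint replace_leftmost (p : pred (letter n)) (g : letter n -> letter n) w
    : word n :=
  if w is x :: w' then
    if p x then g x :: w' else x :: replace_leftmost p g w'
  else [::].

Definition replace_rightmost (p : pred (letter n)) (g : letter n -> letter n) w
    : word n := rev (replace_leftmost p g (rev w)).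

Definition inversion i w : bool :=
  ~~ pairwise [rel x y | ~~ (phi_letter i x && eps_letter i y)] w.

Lemma inversionP i w :
  reflect (exists w1 x w2 y w3,
             [/\ w = w1 ++ x :: w2 ++ y :: w3, phi_letter i x & eps_letter i y])
          (inversion i w).
Proof.
apply: (iffP idP); rewrite /inversion; last first.
  case=> w1 [x [w2 [y [w3 [-> hx hy]]]]]; rewrite pairwise_cat /=.
  rewrite all_cat /= hx hy /= andbF /=; by rewrite !andbF.
elim: w => [|x w IHw] //=; rewrite negb_and => /orP[|/IHw].
  rewrite -has_predC => /hasP[y yw /=]; rewrite negbK => /andP[hx hy].
  case/splitPr: yw => w2 w3.
  by exists [::], x, w2, y, w3.
case=> w1 [x' [w2 [y [w3 [-> hx hy]]]]].
by exists (x :: w1), x', w2, y, w3.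
Qed.

(* None stands for +oo. *)
Definition qeps i w : option nat :=
  if inversion i w then None else Some (count (eps_letter i) w).

Definition qphi i w : option nat :=
  if inversion i w then None else Some (count (phi_letter i) w).

(* None stands for undefined. *)
Definition qe i w : option (word n) :=
  if qeps i w is Some _.+1
  then Some (replace_rightmost (eps_letter i) (raise i) w) else None.

Definition qf i w : option (word n) :=
  if qphi i w is Some _.+1
  then Some (replace_leftmost (phi_letter i) (lower i) w) else None.

Inductive in_component w : word n -> Prop :=
| in_component_refl : in_component w w
| in_component_e i u v :
    in_component w u -> qe i u = Some v -> in_component w v
| in_component_f i u v :
    in_component w u -> qf i u = Some v -> in_component w v.

Definition component w : set (word n) := in_component w.

(* psi is a function on all words, but only its restriction to component u
   matters. The equations with omap say that one side is defined iff the other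
   is, and that psi commutes with the operator when they are. *)
Definition hypo_congr u v : Prop :=
  exists psi : word n -> word n,
    [/\ set_bij (component u) (component v) psi,
        psi u = v
      & forall w, component u w -> forall i,
          [/\ wt (psi w) = wt w,
              qeps i (psi w) = qeps i w,
              qphi i (psi w) = qphi i w,
              qe i (psi w) = omap psi (qe i w)
            & qf i (psi w) = omap psi (qf i w)]].

End QuasiCrystal.

(* Main.v *)
Require Import Defs.
From mathcomp Require Import all_boot.
From mathcomp Require Import all_algebra functions zify.

(** Apply the same operators to u and v and compare the inversions of the
    results. When no letter of a word can be raised by e_i, the powers of f_i
    lower its first m letters in the domain of f_i, for any m of our choice;
    dually for e_i and the last m letters. Applied to all letters, this replaces
    a and b by other pairs, and all pairs with distinct indices can be brought
    to L = j, U = bar (j+1) with j > 1: move the letter of larger index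
    to n or bar n, the other one to n-1 or bar (n-1), and correct the signs.
    Let now u = p L u' and v = p U v' have the same content, so that v' contains
    one more L than u'. Apply e_(j-1) as many times as L occurs in u': this turns
    L into j-1 in u', but leaves exactly one L after p U in v.
    Both L and U are lowered by f_j; apply it |p|+1 times.
    In u no letter L is left and there is no (j-1)-inversion; in v the
    letter U after p has become bar j, and it precedes the remaining L, which is
    a (j-1)-inversion. *)

Set Implicit Arguments.
Unset Strict Implicit.
Unset Printing Implicit Defensive.

Lemma first_difference (T : eqType) (u v : seq T) :
  size u = size v -> u != v ->
  exists (p : seq T) (x y : T) (u' v' : seq T),
    [/\ u = p ++ x :: u', v = p ++ y :: v' & x != y].
Proof.
elim: u v => [|x u IH] [|y v] //= [/IH{}IH]; rewrite eqseq_cons negb_and.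
have [<- /= /IH[p [x' [y' [u' [v' [-> -> h]]]]]]|h _] := eqVneq x y.
  by exists (x :: p), x', y', u', v'.
by exists [::], x, y, u, v.
Qed.

Import GRing.Theory.

Section Separation.
Variable n : nat.
Implicit Types (i j : 'I_n) (a b x y : letter n) (u v w z : word n).
Implicit Types (s : seq (bool * 'I_n)).

(** * Single operators and the letters they change *)

Lemma phi_eps_disjoint i x : phi_letter i x -> ~~ eps_letter i x.
Proof. by case: x => k [] /=; rewrite /phi_letter /eps_letter -?val_eqE /=; lia. Qed.

Lemma phi_lower i x : ~~ phi_letter i (lower i x).
Proof.
rewrite /lower; case: x => k [] /=; rewrite /phi_letter /= ?neq_ltn ?ltnS ?leqnn //.
by case: insubP => [j _ hj|_] /=; rewrite -?val_eqE /= ?hj; lia.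
Qed.

Lemma eps_raise i x : ~~ eps_letter i (raise i x).
Proof.
rewrite /raise; case: x => k [] /=; rewrite /eps_letter /= ?neq_ltn ?ltnS ?leqnn //.
by case: insubP => [j _ hj|_] /=; rewrite -?val_eqE /= ?hj; lia.
Qed.

(** The first letter of an inversion would lie in [w2], and its second letter further right, where
    no candidate is left. *)
Lemma inversion_cat_false i w1 w2 :
  all (predC (phi_letter i)) w1 -> all (predC (eps_letter i)) w2 ->
  inversion i (w1 ++ w2) = false.
Proof.
move=> h1 h2; apply/negbF; elim: w1 h1 => [_|x w1 IH /andP[/negPf hx /IH]] /=.
  elim: w2 h2 => [|x w2 IH] //= /andP[_ h2]; rewrite IH // andbT.
  by apply: sub_all h2 => y /= /negPf->; rewrite andbF.
by move=> ->; rewrite andbT; apply/allP => y _ /=; rewrite hx.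
Qed.

Lemma replace_leftmost_cat (p : pred (letter n)) g w1 x w2 :
  all (predC p) w1 -> p x ->
  replace_leftmost p g (w1 ++ x :: w2) = w1 ++ g x :: w2.
Proof.
move=> + hx; elim: w1 => [|y w1 IH] /=; first by rewrite hx.
by case/andP=> /negPf-> /IH->.
Qed.

Lemma qf_cat i w1 x w2 :
  all (predC (phi_letter i)) w1 -> phi_letter i x ->
  all (predC (eps_letter i)) w2 ->
  qf i (w1 ++ x :: w2) = Some (w1 ++ lower i x :: w2).
Proof.
move=> h1 hx h2; rewrite /qf /qphi inversion_cat_false //=; last first.
  by rewrite h2 phi_eps_disjoint.
by rewrite count_cat /= hx addnCA /= replace_leftmost_cat.
Qed.

Lemma qe_cat i w1 x w2 :
  all (predC (phi_letter i)) w1 -> eps_letter i x ->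
  all (predC (eps_letter i)) w2 ->
  qe i (w1 ++ x :: w2) = Some (w1 ++ raise i x :: w2).
Proof.
move=> h1 hx h2; rewrite /qe /qeps -cat_rcons inversion_cat_false //=; last first.
  by rewrite all_rcons h1 /= andbT; apply: contraL hx; apply: phi_eps_disjoint.
rewrite cat_rcons count_cat /= hx addnCA /= /replace_rightmost rev_cat rev_cons.
rewrite cat_rcons replace_leftmost_cat ?all_rev //.
by rewrite rev_cat rev_cons !revK cat_rcons.
Qed.

(** * Sequences of operators *)

(* The operators are encoded as pairs: (true, i) is e_i, (false, i) is f_i. *)
Definition step (c : bool * 'I_n) w := if c.1 then qe c.2 w else qf c.2 w.

Definition run s w := foldl (fun o c => obind (step c) o) (Some w) s.

Lemma run_cons c s w : run (c :: s) w = obind (run s) (step c w).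
Proof. by rewrite /run /=; case: step => //=; elim: s. Qed.

Lemma run_cat s1 s2 w : run (s1 ++ s2) w = obind (run s2) (run s1 w).
Proof. by rewrite /run foldl_cat; case: (foldl _ _ s1) => //=; elim: s2. Qed.

Definition shift_f i x := if phi_letter i x then lower i x else x.

Definition shift_e i x := if eps_letter i x then raise i x else x.

(** Each step acts on the leftmost letter still in the domain of [f_i]. The letters already lowered
    stand to its left, so no inversion ever arises, and the number of steps decides where the
    process stops. *)
Lemma run_f_prefix i w1 w2 :
  all (predC (eps_letter i)) (w1 ++ w2) ->
  run (nseq (count (phi_letter i) w1) (false, i)) (w1 ++ w2)
  = Some (map (shift_f i) w1 ++ w2).
Proof.
(* Here [z] is the part already processed. *)
suff gen z : all (predC (phi_letter i)) z ->
    all (predC (eps_letter i)) (w1 ++ w2) ->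
    run (nseq (count (phi_letter i) w1) (false, i)) (z ++ w1 ++ w2)
    = Some (z ++ map (shift_f i) w1 ++ w2) by exact: (gen [::]).
elim: w1 z => [|x w1 IH] z //= hz /andP[hx hw]; rewrite -!cat_rcons.
have [hp|hp] := boolP (phi_letter i x); last first.
  by rewrite [shift_f i x]ifN // add0n IH // all_rcons /= hp.
rewrite [shift_f i x]ifT // add1n /= run_cons /step /= cat_rcons qf_cat //=.
by rewrite -cat_rcons IH // all_rcons /= phi_lower.
Qed.

Lemma run_e_suffix i w1 w2 :
  all (predC (phi_letter i)) (w1 ++ w2) ->
  run (nseq (count (eps_letter i) w2) (true, i)) (w1 ++ w2)
  = Some (w1 ++ map (shift_e i) w2).
Proof.
suff gen z : all (predC (eps_letter i)) z ->
    all (predC (phi_letter i)) (w1 ++ w2) ->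
    run (nseq (count (eps_letter i) w2) (true, i)) ((w1 ++ w2) ++ z)
    = Some (w1 ++ map (shift_e i) w2 ++ z).
  by move=> h; move: (gen [::]); rewrite !cats0; apply.
elim/last_ind: w2 z => [|w2 x IH] z /= hz; rewrite ?cats0 //.
rewrite -rcons_cat all_rcons map_rcons => /andP[hx hw].
rewrite -cats1 count_cat /= addn0 -cats1 -!catA.
have [hp|hp] := boolP (eps_letter i x); last first.
  rewrite [shift_e i x]ifN // addn0 catA cat1s.
  by rewrite IH /= ?hp ?hz // -cats1 -!catA.
rewrite [shift_e i x]ifT // addn1 /= run_cons /step /= catA qe_cat //=.
by rewrite IH /= ?eps_raise ?hz // -cats1 -!catA.
Qed.

(** * Comparing words by inversions along operator sequences *)

(** This consequence of the congruence mentions no bijection and passes to the results of a common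
    run. Equality under [omap] also says that a run is defined on both words or on neither. *)
Definition indist u v :=
  forall s i, omap (inversion i) (run s u) = omap (inversion i) (run s v).

Lemma indist_sym u v : indist u v -> indist v u.
Proof. by move=> h s i; rewrite h. Qed.

Lemma indist_run s u v u' v' :
  run s u = Some u' -> run s v = Some v' -> indist u v -> indist u' v'.
Proof. by move=> hu hv h t i; move: (h (s ++ t) i); rewrite !run_cat hu hv. Qed.

(** The bijection commutes with runs, and an inversion is visible as the value [None] of [qeps]. *)
Lemma hypo_congr_indist u v : hypo_congr u v -> indist u v.
Proof.
case=> psi [_ <- hpsi] s i.
suff gen w : in_component u w ->
    omap (inversion i) (run s w) = omap (inversion i) (run s (psi w)).
  exact/gen/in_component_refl.
elim: s w => [|[c k] s IH] w cw; rewrite ?run_cons /step /=.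
  have [_ + _ _ _] := hpsi w cw i.
  by rewrite /qeps; do 2!case: inversion.
have [_ _ _ he hf] := hpsi w cw k.
case: c; rewrite ?he ?hf.
- case e: (qe k w) => [w'|] //=; apply: IH; exact: in_component_e cw e.
- case e: (qf k w) => [w'|] //=; apply: IH; exact: in_component_f cw e.
Qed.

(** * Pairs of letters and their transport by operators *)

(** Equal content ensures that one number of operator applications exhausts both words. *)
Definition separated a b := forall u v,
  all (mem [:: a; b]) u -> all (mem [:: a; b]) v -> perm_eq u v ->
  indist u v -> u = v.

Lemma separated_sym a b : separated a b -> separated b a.
Proof.
have e : mem [:: a; b] =1 mem [:: b; a] by move=> x; rewrite /= !inE orbC.
by move=> h u v; rewrite -!(eq_all e); apply: h.
Qed.

Lemma separated_map (g : letter n -> letter n) a b :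
  g a != g b ->
  (forall u v, all (mem [:: a; b]) u -> all (mem [:: a; b]) v -> perm_eq u v ->
     indist u v -> indist (map g u) (map g v)) ->
  separated (g a) (g b) -> separated a b.
Proof.
move=> gab hg sep u v hu hv uv iuv.
have ginj : {in [:: a; b] &, injective g}.
  move=> x y; rewrite !inE => /orP[]/eqP-> /orP[]/eqP-> // e.
    by rewrite e eqxx in gab.
  by rewrite e eqxx in gab.
have gall w : all (mem [:: a; b]) w -> all (mem [:: g a; g b]) (map g w).
  rewrite all_map; apply: sub_all => x /=; rewrite !inE.
  by case/orP=> /eqP->; rewrite eqxx ?orbT.
apply: (inj_in_map ginj) => //; apply: sep; rewrite ?gall ?perm_map //.
exact: hg.
Qed.

Lemma all_pair (p : pred (letter n)) a b w :
  p a -> p b -> all (mem [:: a; b]) w -> all p w.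
Proof. by move=> pa pb; apply: sub_all => x; rewrite !inE => /orP[]/eqP->. Qed.

(** Take the whole word as the prefix in [run_f_prefix]: every letter is shifted, after equally many
    steps in [u] and in [v]. *)
Lemma separated_f i a b :
  ~~ eps_letter i a -> ~~ eps_letter i b -> shift_f i a != shift_f i b ->
  separated (shift_f i a) (shift_f i b) -> separated a b.
Proof.
move=> ha hb hab; apply: separated_map => // u v hu hv uv.
have := @run_f_prefix i u [::]; rewrite !cats0 => /(_ (all_pair _ _ hu)) ru.
have := @run_f_prefix i v [::]; rewrite !cats0 => /(_ (all_pair _ _ hv)) rv.
apply: indist_run (ru ha hb) _; rewrite (permP uv); exact: rv.
Qed.

Lemma separated_e i a b :
  ~~ phi_letter i a -> ~~ phi_letter i b -> shift_e i a != shift_e i b ->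
  separated (shift_e i a) (shift_e i b) -> separated a b.
Proof.
move=> ha hb hab; apply: separated_map => // u v hu hv uv.
have ru := @run_e_suffix i [::] u (all_pair ha hb hu).
have rv := @run_e_suffix i [::] v (all_pair ha hb hv).
by apply: indist_run ru _; rewrite (permP uv).
Qed.

Lemma lower_succ i j : j = i.+1 :> nat -> lower i (i, false) = (j, false).
Proof. by rewrite /lower /= => <-; rewrite valK. Qed.

Lemma raise_succ i j : j = i.+1 :> nat -> raise i (i, true) = (j, true).
Proof. by rewrite /raise /= => <-; rewrite valK. Qed.

Lemma lower_last i : i.+1 = n -> lower i (i, false) = (i, true).
Proof. by rewrite /lower /= => e; rewrite insubF // e ltnn. Qed.

Lemma raise_last i : i.+1 = n -> raise i (i, true) = (i, false).
Proof. by rewrite /raise /= => e; rewrite insubF // e ltnn. Qed.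

(** * The base pair: words that first differ in L against U *)

Section Difference.
Variables (j0 j1 j2 : 'I_n) (p u' v' : word n).
Hypotheses (hj1 : j1 = j0.+1 :> nat) (hj2 : j2 = j1.+1 :> nat).

Local Notation L := ((j1, false) : letter n).
Local Notation U := ((j2, true) : letter n).

Lemma not_indist_diff :
  all (mem [:: L; U]) (p ++ L :: u') -> all (mem [:: L; U]) (p ++ U :: v') ->
  perm_eq (p ++ L :: u') (p ++ U :: v') ->
  ~ indist (p ++ L :: u') (p ++ U :: v').
Proof.
have [pL0 pU0] : ~~ phi_letter j0 L /\ ~~ phi_letter j0 U.
  by rewrite /phi_letter /= -!val_eqE /=; lia.
have [eL0 eU0 eK0] : [/\ eps_letter j0 L, ~~ eps_letter j0 U
                       & ~~ eps_letter j0 (j0, false)].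
  by rewrite /eps_letter /= -!val_eqE /=; split; lia.
have [pL1 pU1] : phi_letter j1 L /\ phi_letter j1 U.
  by rewrite /phi_letter /= -!val_eqE /=; lia.
have [eL1 eU1 eK1] : [/\ ~~ eps_letter j1 L, ~~ eps_letter j1 U
                       & ~~ eps_letter j1 (j0, false)].
  by rewrite /eps_letter /= -!val_eqE /=; split; lia.
have eL'0 : ~~ eps_letter j0 (shift_f j1 L).
  by rewrite /shift_f pL1 (lower_succ hj2) /eps_letter /=; clear -hj1 hj2; lia.
have eU'0 : ~~ eps_letter j0 (shift_f j1 U).
  by rewrite /shift_f pU1 /lower /eps_letter /= -val_eqE /=; clear -hj1; lia.
have pU'0 : phi_letter j0 (shift_f j1 U).
  by rewrite /shift_f pU1 /lower /phi_letter /= hj1.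
move=> hu hv uv iuv.
have sL : shift_e j0 L = (j0, false) by rewrite /shift_e eL0.
have sU : shift_e j0 U = U by rewrite /shift_e (negPf eU0).
have s0 w : all (mem [:: L; U]) w ->
    all (predC (eps_letter j0)) (map (shift_e j0) w).
  by rewrite all_map; apply: all_pair; rewrite /= ?sL ?sU.
have s1 w : all (mem [:: L; U]) w ->
    all (predC (eps_letter j1)) (map (shift_e j0) w).
  by rewrite all_map; apply: all_pair; rewrite /= ?sL ?sU.
have e1 w : all (mem [:: L; U]) w -> all (predC (eps_letter j1)) w.
  exact: all_pair.
have p0 w : all (mem [:: L; U]) w -> all (predC (phi_letter j0)) w.
  exact: all_pair.
(* Both letters lie in the domain of [f_j1], so the same number of steps reaches exactly the end of
   [rcons p x], whichever letter [x] is. *)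
have szE x : x \in [:: L; U] -> all (mem [:: L; U]) p ->
    count (phi_letter j1) (rcons p x) = (size p).+1.
  move=> hx hp; rewrite -(size_rcons p x); apply/eqP; rewrite -all_count.
  by apply: (all_pair pL1 pU1); rewrite all_rcons hp andbT.
(* Cut [v'] at its first L. Then [v2] has as many L as [u'], and the powers of [e_j0] stop just
   before this L. *)
have [v1 [v2 [ev cv]]] : exists v1 v2,
    v' = v1 ++ L :: v2 /\ count (eps_letter j0) v2 = count (eps_letter j0) u'.
  have cE : (count (eps_letter j0) u').+1 = count (eps_letter j0) v'.
    move/permP/(_ (eps_letter j0)): uv.
    by rewrite !count_cat /= eL0 (negPf eU0) => /addnI.
  have hv0 : has (eps_letter j0) v' by rewrite has_count -cE.
  case: (split_find hv0) hv cE => x v1 v2 hx hv1 hv cE.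
  have xL : x = L.
    move: hv hx; rewrite cat_rcons !all_cat /= all_cat /= !inE.
    by case/and5P=> _ _ _ /orP[]/eqP-> // _; rewrite (negPf eU0).
  exists v1, v2; rewrite cat_rcons xL; split=> //.
  move: cE; rewrite cat_rcons xL count_cat /= eL0.
  by move: hv1; rewrite has_count -eqn0Ngt => /eqP-> [].
move: hu hv; rewrite {}ev in iuv *; rewrite !all_cat /= !all_cat /=.
case/and3P=> hp hL hu' /and5P[_ hU hv1 _ hv2].
have hrc x : x \in [:: L; U] -> all (mem [:: L; U]) (rcons p x).
  by rewrite all_rcons hp andbT.
have ru : run (nseq (count (eps_letter j0) u') (true, j0)
               ++ nseq (size p).+1 (false, j1)) (p ++ L :: u')
    = Some (map (shift_f j1) (rcons p L) ++ map (shift_e j0) u').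
  rewrite -(szE L) ?mem_head // run_cat -cat_rcons run_e_suffix /=; last first.
    by rewrite p0 // all_cat hrc ?hu' ?mem_head.
  rewrite run_f_prefix // all_cat s1 // andbT e1 //.
  by rewrite hrc ?mem_head.
have rv : run (nseq (count (eps_letter j0) u') (true, j0)
               ++ nseq (size p).+1 (false, j1)) (p ++ U :: v1 ++ L :: v2)
    = Some (map (shift_f j1) (rcons p U) ++ v1 ++ L :: map (shift_e j0) v2).
  rewrite -(szE U) // run_cat -cv -cat_rcons -(cat_rcons L) catA.
  rewrite run_e_suffix /=; last first.
    by rewrite p0 // -catA !cat_rcons !all_cat /= !all_cat /= hp hU hv1 hL hv2.
  rewrite -catA (cat_rcons L) run_f_prefix //.
  by rewrite !all_cat /= eL1 s1 // andbT !e1 // hrc.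
have /(_ [::] j0) [] := indist_run ru rv iuv.
(* The result from [u] has no letter in the domain of [e_j0] at all, hence the empty left factor. *)
rewrite -[X in inversion j0 X = _]cat0s inversion_cat_false //; last first.
  rewrite all_cat s0 // andbT all_map; apply: (@all_pair _ L U) => //.
  by rewrite hrc.
move=> /esym/negbT/negP; apply; apply/inversionP.
(* The lowered U is the bar of [j1], that is of [j0 + 1], and L is [j0 + 1] itself. *)
exists (map (shift_f j1) p), (shift_f j1 U), v1, L, (map (shift_e j0) v2).
by split=> //; rewrite map_rcons cat_rcons.
Qed.
End Difference.

(** The index [j0] carries the inversion that distinguishes the words; its existence is where three
    indices are required. *)
Lemma separated_consecutive (j0 j1 j2 : 'I_n) :
  j1 = j0.+1 :> nat -> j2 = j1.+1 :> nat -> separated (j1, false) (j2, true).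
Proof.
move=> hj1 hj2 u v hu hv uv iuv; apply/eqP/negP => /negP ne.
have [p [x [y [u' [v' [eu ev xy]]]]]] := first_difference (perm_size uv) ne.
have : x \in [:: (j1, false); (j2, true)].
  by apply: (allP hu); rewrite eu mem_cat mem_head orbT.
have : y \in [:: (j1, false); (j2, true)].
  by apply: (allP hv); rewrite ev mem_cat mem_head orbT.
move: hu hv uv iuv xy; rewrite {}eu {}ev !inE => hu hv uv iuv.
move=> + /orP[]/eqP ey /orP[]/eqP ex; subst x y; rewrite ?eqxx // => _.
  move/indist_sym: iuv; rewrite perm_sym in uv.
  exact: not_indist_diff hj1 hj2 _ _ _.
exact: not_indist_diff hj1 hj2 _ _ _ iuv.
Qed.

(** * Reduction of all pairs with distinct indices to the base pair *)

(** An unbarred letter moves up by [f_i], a barred one by [e_i]; both operators fix [y], whose index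
    is neither [i] nor [j]. *)
Lemma separated_up i j c y : j = i.+1 :> nat -> y.1 != i -> y.1 != j ->
  separated (j, c) y -> separated (i, c) y.
Proof.
move=> hj yi yj sep.
have py : ~~ phi_letter i y.
  by move: yi yj; rewrite /phi_letter -!val_eqE /=; case: y.2; lia.
have ey : ~~ eps_letter i y.
  by move: yi yj; rewrite /eps_letter -!val_eqE /=; case: y.2; lia.
have ne : (j, c) != y by apply: contraNneq yj => <-.
case: c sep ne => sep ne.
- have e : shift_e i (i, true) = (j, true).
    by rewrite /shift_e /eps_letter /= eqxx (raise_succ hj).
  have e' : shift_e i y = y by rewrite /shift_e (negPf ey).
  by apply: (@separated_e i); rewrite ?e ?e' // /phi_letter /=; lia.
- have e : shift_f i (i, false) = (j, false).
    by rewrite /shift_f /phi_letter /= eqxx (lower_succ hj).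
  have e' : shift_f i y = y by rewrite /shift_f (negPf py).
  by apply: (@separated_f i); rewrite ?e ?e' // /eps_letter /=; lia.
Qed.

Lemma separated_flip i c y : i.+1 = n -> y.1 != i ->
  separated (i, ~~ c) y -> separated (i, c) y.
Proof.
move=> hi yi sep; have ltn := ltn_ord y.1.
have py : ~~ phi_letter i y.
  by move: yi; rewrite /phi_letter -!val_eqE /=; case: y.2; lia.
have ey : ~~ eps_letter i y.
  by move: yi; rewrite /eps_letter -!val_eqE /=; case: y.2; lia.
have ne : (i, ~~ c) != y by apply: contraNneq yi => <-.
case: c sep ne => /= sep ne.
- have e : shift_e i (i, true) = (i, false).
    by rewrite /shift_e /eps_letter /= eqxx raise_last.
  have e' : shift_e i y = y by rewrite /shift_e (negPf ey).
  by apply: (@separated_e i); rewrite ?e ?e' // /phi_letter /=; lia.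
- have e : shift_f i (i, false) = (i, true).
    by rewrite /shift_f /phi_letter /= eqxx lower_last.
  have e' : shift_f i y = y by rewrite /shift_f (negPf py).
  by apply: (@separated_f i); rewrite ?e ?e' // /eps_letter /=; lia.
Qed.

(** Here [e_i] moves both letters at once, the bar of [i] to the bar of [j] and [j] to [i], so the
    two indices trade places. *)
Lemma separated_cross i j : j = i.+1 :> nat ->
  separated (i, false) (j, true) -> separated (i, true) (j, false).
Proof.
move=> hj sep.
have e : shift_e i (i, true) = (j, true).
  by rewrite /shift_e /eps_letter /= eqxx (raise_succ hj).
have e' : shift_e i (j, false) = (i, false).
  by rewrite /shift_e /eps_letter /= hj eqxx.
apply: (@separated_e i); rewrite ?e ?e' //; first by rewrite /phi_letter /=; lia.
  by rewrite /phi_letter /= -val_eqE /=; lia.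
  by apply/eqP; case.
exact: separated_sym.
Qed.

Lemma separated_ltn (a b : letter n) : 3 <= n -> a.1 < b.1 -> separated a b.
Proof.
(* Induction on the total distance of the two indices from [n]. *)
move=> hn; have [m] := ubnP ((n - a.1) + (n - b.1)).
elim: m a b => // m IH [i c] [j d] /= hm ij.
have [ltin ltjn] := (ltn_ord i, ltn_ord j).
have [hj|hj] := ltnP j.+1 n.
  apply: separated_sym; apply: (@separated_up j (Ordinal hj)) => //=.
  - by rewrite -val_eqE /=; lia.
  - by rewrite -val_eqE /=; lia.
  - by apply/separated_sym/IH => /=; lia.
have [hi|hi] := ltnP i.+1 j.
  apply: (@separated_up i (Ordinal (ltn_trans hi ltjn))) => //=.
  - by rewrite -val_eqE /=; lia.
  - by rewrite -val_eqE /=; lia.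
  - by apply: IH => /=; lia.
(* Now [j] is the last index and [i] the one before; [3 <= n] makes [i] positive, so [i.-1] is a
   true predecessor. *)
have lt0 : i.-1 < n by lia.
have sep : separated (i, false) (j, true).
  by apply: (@separated_consecutive (Ordinal lt0)) => /=; lia.
have flip c' d' : separated (i, c') (j, ~~ d') -> separated (i, c') (j, d').
  move=> h; apply/separated_sym/separated_flip; last exact: separated_sym.
    by lia.
  by rewrite -val_eqE /=; lia.
have cross : separated (i, true) (j, false) by apply: separated_cross => //; lia.
(* Opposite signs are settled by [sep] and [cross]; equal signs reduce to them by flipping the
   letter at the last index. *)
by case: c {hm}; case: d => //; apply: flip.
Qed.

(** * The weight determines the content *)

Lemma wt_count a w : bar a \notin w ->
  wt w ord0 a.1 = ((-1) ^+ a.2 * (count_mem a w)%:Z)%R.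
Proof.
case: a => i [] /count_memPn /= h; rewrite mxE.
  by rewrite h expr1 mulN1r sub0r.
by rewrite h subr0 expr0 mul1r.
Qed.

(** Since [a] is not the bar of [b], no letter occurs together with its bar. Nothing cancels in the
    weight, and each multiplicity is a coordinate up to sign. *)
Lemma wt_perm_eq a b u v : a <> bar b ->
  all (mem [:: a; b]) u -> all (mem [:: a; b]) v -> wt u = wt v -> perm_eq u v.
Proof.
move=> ab hu hv e.
have bar_neq x : x != bar x by rewrite /bar; case: x => k [] /=; apply/eqP; case.
have barK x : bar (bar x) = x by case: x => k [].
have nb x w : all (mem [:: a; b]) w -> x \in [:: a; b] -> bar x \notin w.
  move=> hw hx; apply/negP => /(allP hw) hb.
  move: hx (bar_neq x); rewrite !inE => hx nx.
  move: hb; rewrite !inE; case/orP: hx nx => /eqP-> nx /orP[]/eqP h.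
  - by rewrite h eqxx in nx.
  - by case: ab; rewrite -h barK.
  - exact: ab.
  - by rewrite h eqxx in nx.
apply/allP => x; rewrite mem_cat => hx; have {}hx : x \in [:: a; b].
  by case/orP: hx; apply/allP.
have := congr1 (fun m : 'rV_n => m ord0 x.1) e; rewrite /= !wt_count ?nb //.
by move/(can_inj (signrMK _)) => [] /eqP.
Qed.

End Separation.

Theorem theorem9p34 (n : nat) (hn : 3 <= n) (a b : letter n) (hab : a <> bar b)
    (u v : word n) (hu : {subset u <= [:: a; b]}) (hv : {subset v <= [:: a; b]}) :
  hypo_congr u v <-> u = v.
Proof.
split=> [uv|->].
  have iuv := hypo_congr_indist uv.
  have {}hu : all (mem [:: a; b]) u by apply/allP.
  have {}hv : all (mem [:: a; b]) v by apply/allP.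
  have puv : perm_eq u v.
    apply: (wt_perm_eq hab) => //; case: uv => psi [_ <- h].
    by case: (h u (in_component_refl u) a.1) => ->.
  have [e|e|e] := ltngtP a.1 b.1.
  - exact: (separated_ltn hn e).
  - exact: (separated_sym (separated_ltn hn e)).
  (* With equal indices, [a <> bar b] leaves only [a = b]: both words are powers of one letter, of
     the same length. *)
  - have ab : a = b.
      case: a b e hab {hu hv} => [i c] [j d] /= /val_inj-> h.
      by congr pair; case: c d h => [] [] // [].
    rewrite -ab in hu hv.
    have nseq_a w : all (mem [:: a; a]) w -> w = nseq (size w) a.
      by move=> h; apply/all_pred1P; apply: sub_all h => x; rewrite !inE orbb.
    by rewrite (nseq_a u hu) (nseq_a v hv) (perm_size puv).
exists id; split=> // [|w _ i]; last by split=> //; [case: qe | case: qf].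
by split=> // x cx; exists x.
Qed.
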